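(* Let $\vec G_1(n)$ be the random functional digraph on vertex set $\{1,\dots,n\}$, whose edges are $(i,\pi(i))$ for $i=1,\dots,n$, where $\pi$ is a uniformly random function $\{1,\dots,n\}\to\{1,\dots,n\}$, and let $G_n$ be the graph obtained from it by ignoring orientations (and loops and repeated edges). Then $\iota(G_n)\sim1/2$ with high probability, i.e. for every $\delta>0$, $\mathbb P[|\iota(G_n)-1/2|>\delta]\to0$ as $n\to\infty$.
   Context: For a finite graph $G$, order its vertices uniformly at random and build the random greedy maximal independent set $\mathbf I(G)$ by considering the vertices one by one in this order, adding the current vertex if and only if it is not adjacent to any previously added vertex. Let $\iota(G)=|\mathbf I(G)|/|V(G)|$. When the graph is itself random, the ordering is independent of the graph, and probabilities are over both sources of randomness. *)

(* Defs.v *)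
From mathcomp Require Import all_boot all_order all_fingroup all_algebra.
From mathcomp Require Import all_classical all_reals all_analysis.

Set Implicit Arguments.
Unset Strict Implicit.
Unset Printing Implicit Defensive.

Local Open Scope ring_scope.

Record sgraph (T : finType) := SGraph {
  adj :> rel T;
  adj_sym : symmetric adj;
  adj_irr : irreflexive adj
}.

Section Greedy.
Variables (T : finType) (G : sgraph T).

Definition greedy_step (I : {set T}) (v : T) : {set T} :=
  if [exists u in I, G u v] then I else v |: I.

Definition greedy_set (s : seq T) : {set T} := foldl greedy_step finset.set0 s.

(* A permutation s encodes the ordering in which the k-th vertex considered is
   the image under s of the k-th element of [enum T]; this is a bijection
   between permutations and orderings. *)
Definition vertex_order (s : {perm T}) : seq T := [seq s x | x <- enum T].

Definition greedy_mis (s : {perm T}) : {set T} := greedy_set (vertex_order s).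

Definition greedy_ratio (R : realType) (s : {perm T}) : R :=
  #|greedy_mis s|%:R / #|T|%:R.
End Greedy.

Section Underlying.
Variables (T : finType) (d : rel T).

Definition underlying_rel : rel T :=
  fun x y => (x != y) && (d x y || d y x).

Lemma underlying_rel_sym : symmetric underlying_rel.
Proof. by move=> x y; rewrite /underlying_rel eq_sym orbC. Qed.

Lemma underlying_rel_irr : irreflexive underlying_rel.
Proof. by move=> x; rewrite /underlying_rel eqxx. Qed.

Definition underlying : sgraph T :=
  SGraph underlying_rel_sym underlying_rel_irr.
End Underlying.

Definition functional_digraph (T : finType) (f : {ffun T -> T}) : rel T :=
  fun x y => f x == y.

(* Probability of an event under the uniform distribution on a finite type.
   On a product type this is the joint law of independent uniform elements. *)
Definition unif_prob (R : realType) (W : finType) (E : pred W) : R :=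
  #|[pred w | E w]|%:R / #|W|%:R.

(* Main.v *)
Require Import Defs.
From mathcomp Require Import all_boot all_order all_fingroup all_algebra.
From mathcomp Require Import all_classical all_reals all_analysis.
From mathcomp Require Import ring lra.

(** Relabelling the vertices by the ordering, we may process 0, ..., n-1 in this
order. Before vertex k is processed, let A be the number of chosen vertices, D
the number of chosen j with f j >= k, and m = n - k. Given the graph on
0, ..., k-1, the values f j of those D vertices are independent and uniform on
k, ..., n-1, and f k is uniform and independent of everything; resampling them
gives, for every phi and t and with E_k the expectation just before vertex k is
processed, as long as k + 1 < n,
  E_(k+1) [phi(A) (1 + t/(m-1))^D] = E_k [phi(A) (1 + t/m)^D]
    + 1/n E_k [(1 + (t-1)/m)^D (t phi(A+1) + (n - A) (phi(A+1) - phi(A)))].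
Put Z = (1 + 1/m)^D, Y = (1 + 2/m)^D and B = n + 1 - A. Then E Z = 1 + k/n and
E Y <= (1 + k/n)^2, while the increments for B Z and B (B + 1) Y vanish, so that
E [B Z] = n + 1 and E [B (B + 1) Y] = (n + 1) (n + 2). Since Z^2 is at most
(1 + 1/m^2)^n Y, both Z and B Z concentrate as long as n/m^2 is small, hence
B (1 + k/n) is close to n + 1. For m a small multiple of n this says that A is
close to n/2, up to the contribution of the last m vertices. *)

Set Implicit Arguments.
Unset Strict Implicit.
Unset Printing Implicit Defensive.

Import Order.TTheory GRing.Theory Num.Theory.
Import numFieldNormedType.Exports.

Local Open Scope ring_scope.

(** * Greedy sets: dependence on the explored edges, and equivariance *)

Lemma greedy_set_rcons (T : finType) (G : sgraph T) (s : seq T) (v : T) :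
  greedy_set G (rcons s v) = greedy_step G (greedy_set G s) v.
Proof. by rewrite /greedy_set foldl_rcons. Qed.

Lemma greedy_set_sub (T : finType) (G : sgraph T) (s : seq T) :
  {subset greedy_set G s <= s}.
Proof.
elim/last_ind: s => [x|s v IHs x]; first by rewrite inE.
rewrite greedy_set_rcons mem_rcons inE /greedy_step.
case: ifP => _; first by move=> /IHs ->; rewrite orbT.
by rewrite !inE => /orP[->//|/IHs ->]; rewrite orbT.
Qed.

(** Every chosen vertex comes from [s], so a greedy step along [s] only tests edges between entries
    of [s]. *)
Lemma greedy_set_eq (T : finType) (G H : sgraph T) (s : seq T) :
  {in s &, G =2 H} -> greedy_set G s = greedy_set H s.
Proof.
elim/last_ind: s => [//|s v IHs] GH; rewrite !greedy_set_rcons IHs; last first.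
  by move=> x y xs ys; apply: GH; rewrite mem_rcons inE ?xs ?ys orbT.
rewrite /greedy_step; congr (if _ then _ else _).
apply: eq_existsb => u; case: (boolP (u \in _)) => //= /greedy_set_sub us.
by apply: GH; rewrite mem_rcons inE ?us ?eqxx ?orbT.
Qed.

Lemma greedy_set_map (T : finType) (G H : sgraph T) (p : {perm T}) (s : seq T) :
  (forall x y, H (p x) (p y) = G x y) ->
  greedy_set H (map p s) = p @: greedy_set G s.
Proof.
move=> HG; elim/last_ind: s => [|s v IHs]; first by rewrite imset0.
rewrite map_rcons !greedy_set_rcons IHs /greedy_step.
have -> : [exists u in p @: greedy_set G s, H u (p v)]
        = [exists u in greedy_set G s, G u v].
  apply/existsP/existsP => -[u /andP[]].
    by move=> /imsetP[w ws ->]; rewrite HG => Gwv; exists w; rewrite ws.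
  by move=> us Guv; exists (p u); rewrite HG Guv imset_f.
by case: ifP => // _; rewrite imsetU imset_set1.
Qed.

(** * Finite averaging: classes and product families *)

Section Average.
Variables (R : numFieldType) (W : finType).

(** Double counting: [y] enters the averages of the [#|e y|] points related to it, each time with
    weight [1 / #|e y|]. *)
Lemma sum_class_average (e : rel W) (H : W -> R) :
  reflexive e -> symmetric e -> (forall x y, e x y -> #|e x| = #|e y|) ->
  \sum_x H x = \sum_x (\sum_(y | e x y) H y) / #|e x|%:R.
Proof.
move=> er es ec; under [RHS]eq_bigr do rewrite mulr_suml big_mkcond.
rewrite exchange_big /=; apply: eq_bigr => y _; rewrite -big_mkcond /=.
rewrite (eq_bigr (fun _ => H y / #|e y|%:R)) => [|x /ec -> //].
rewrite (eq_bigl (mem (e y))) => [|x]; last by rewrite /= es.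
rewrite sumr_const -[RHS]mulr_natr mulfVK // pnatr_eq0 -lt0n.
by apply/card_gt0P; exists y; rewrite unfold_in er.
Qed.

End Average.

(** Independence: a uniform element of a product family has independent uniform coordinates, so the
    mean of a product is the product of the means. *)
Lemma sum_family (R : numFieldType) (I J : finType) (F : I -> pred J) (w : I -> J -> R) :
  (\sum_(f in family F) \prod_i w i (f i)) / #|family F|%:R
  = \prod_i ((\sum_(j in F i) w i j) / #|F i|%:R).
Proof.
rewrite -bigA_distr_big_dep prodf_div; congr (_ / _).
by rewrite card_family foldrE big_image /= natr_prod.
Qed.

(** * Exploring a functional graph in the natural order of its vertices *)

Section Exploration.
Variable n : nat.
Implicit Types (f g : {ffun 'I_n -> 'I_n}) (k : 'I_n) (i : nat).

Definition mis_prefix f i : {set 'I_n} :=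
  greedy_set (underlying (functional_digraph f)) (take i (enum 'I_n)).

Definition forward f i : {set 'I_n} := [set j in mis_prefix f i | (i <= f j)%N].

Lemma mem_take_enum_ord (x : 'I_n) i : (x \in take i (enum 'I_n)) = (x < i)%N.
Proof. by rewrite in_take ?mem_enum // index_enum_ord. Qed.

Lemma mis_prefix_lt f i x : x \in mis_prefix f i -> (x < i)%N.
Proof. by move/greedy_set_sub; rewrite mem_take_enum_ord. Qed.

Lemma mis_prefix0 f : mis_prefix f 0 = finset.set0.
Proof. by rewrite /mis_prefix take0. Qed.

(** A chosen [u] is adjacent to [k] either through [f k = u] or through [f u = k]; in the latter
    case [u] lies in [forward f k]. A loop at [k] does no harm, since [k] is not yet chosen. *)
Lemma mis_prefixS f k :
  mis_prefix f k.+1 =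
  if (f k \notin mis_prefix f k) && [forall u in forward f k, f u != k]
  then k |: mis_prefix f k else mis_prefix f k.
Proof.
rewrite /mis_prefix (take_nth k) ?size_enum_ord // nth_ord_enum greedy_set_rcons.
rewrite -/(mis_prefix f k) /greedy_step -if_neg; congr (if _ then _ else _).
rewrite negb_exists; apply/forallP/andP => [noadj|[fk /forallP nof] u].
  split.
    have := noadj (f k); rewrite /= /underlying_rel /functional_digraph.
    case: (boolP (f k \in _)) => //= /mis_prefix_lt lt.
    by rewrite eqxx orbT andbT negbK => /eqP e; rewrite e ltnn in lt.
  apply/forallP => u; apply/implyP; rewrite inE => /andP[uI _].
  have := noadj u; rewrite uI /= /underlying_rel /functional_digraph.
  have /negPf-> /= : u != k by apply: contraTneq (mis_prefix_lt uI) => ->; rewrite ltnn.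
  by rewrite negb_or => /andP[].
case: (boolP (u \in _)) => //= uI.
rewrite /underlying_rel /functional_digraph negb_and negb_or; apply/orP; right.
apply/andP; split; last by apply: contraNneq fk => ->.
apply/eqP => fuk; have := nof u.
by rewrite inE uI fuk leqnn eqxx.
Qed.

(** * Resampling the values that the explored graph leaves free *)

Definition resample f k (j : 'I_n) : pred 'I_n :=
  if j \in forward f k then [pred x : 'I_n | (k <= x)%N]
  else if j == k then predT else pred1 (f j).

(** The conditioning on the past, as a class of functions: the forward vertices take any value from
    [k] on, [k] takes any value, and every other value is frozen. Being a product family, the class
    has independent coordinates. *)
Definition resampled k f : pred {ffun 'I_n -> 'I_n} := family (resample f k).

Lemma notin_mis_prefix f k : k \notin mis_prefix f k.
Proof. by apply/negP => /mis_prefix_lt; rewrite ltnn. Qed.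

Lemma notin_forward f k : k \notin forward f k.
Proof. by rewrite inE negb_and notin_mis_prefix. Qed.

Lemma resampled_refl k : reflexive (resampled k).
Proof.
move=> f; apply/familyP => j; rewrite /resample.
case: ifP => [|_]; first by rewrite inE => /andP[].
by case: ifP; rewrite ?inE.
Qed.

(** For [u < k], either [f u] is frozen or both [f u] and [g u] are at least [k]; hence the edges
    among the vertices below [k] agree. *)
Lemma resampled_mis_prefix k f g : resampled k f g -> mis_prefix g k = mis_prefix f k.
Proof.
move=> /familyP fg; apply: greedy_set_eq => x y.
rewrite !mem_take_enum_ord => xk yk; rewrite /= /underlying_rel /functional_digraph.
have main (u v : 'I_n) : (u < k)%N -> (v < k)%N -> (g u == v) = (f u == v).
  move=> uk vk; have := fg u; rewrite /resample; case: ifP; rewrite inE.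
    move=> /andP[_ kf]; rewrite inE => kg.
    by rewrite -!val_eqE /= !gtn_eqF ?(leq_trans vk).
  by case: eqVneq => [uk'|_ _]; [rewrite uk' ltnn in uk|rewrite inE => /eqP ->].
by rewrite !main.
Qed.

Lemma resampled_forward k f g : resampled k f g -> forward g k = forward f k.
Proof.
move=> fg; apply/setP => j; rewrite !inE (resampled_mis_prefix fg).
case: (boolP (j \in mis_prefix f k)) => //= jI.
have /familyP/(_ j) := fg; rewrite /resample inE jI /=.
case: ifP => [kf|kf]; first by rewrite inE => ->.
case: eqVneq => [jk|_]; last by rewrite inE => /eqP->; rewrite kf.
by have := mis_prefix_lt jI; rewrite jk ltnn.
Qed.

Lemma resampled_sym k : symmetric (resampled k).
Proof.
suff imp f g : resampled k f g -> resampled k g f.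
  by move=> f g; apply/idP/idP; apply: imp.
move=> fg; apply/familyP => j; rewrite /resample (resampled_forward fg).
case: ifP => [|jS]; first by rewrite inE => /andP[].
case: ifP => // jk; have /familyP/(_ j) := fg; rewrite /resample jS jk.
by rewrite !inE eq_sym.
Qed.

Lemma card_ord_lt i : (i <= n)%N -> #|[set x : 'I_n | (x < i)%N]| = i.
Proof.
move=> le_in; rewrite -sum1_card (eq_bigl (fun x : 'I_n => (x < i)%N)); last first.
  by move=> x; rewrite inE.
by rewrite -(big_ord_widen _ (fun=> 1%N) le_in) sum1_card card_ord.
Qed.

Lemma card_ord_ge i : (i <= n)%N -> #|[pred x : 'I_n | (i <= x)%N]| = (n - i)%N.
Proof.
move=> le_in; have := cardsC [set x : 'I_n | (x < i)%N].
rewrite card_ord card_ord_lt // => cardE; rewrite -[RHS](congr1 (subn^~ i) cardE) addKn.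
by apply: eq_card => x; rewrite !inE -leqNgt.
Qed.

Lemma card_resampled k f :
  #|resampled k f| = (#|[pred x : 'I_n | (k <= x)%N]| ^ #|forward f k| * n)%N.
Proof.
rewrite [LHS]card_family foldrE big_image /=.
rewrite (bigID (mem (forward f k))) /=; congr (_ * _)%N.
  rewrite (eq_bigr (fun=> #|[pred x : 'I_n | (k <= x)%N]|)) ?prod_nat_const //.
  by move=> j jS; rewrite /resample jS.
rewrite (bigD1 k) ?notin_forward //= big1 => [|j /andP[/negPf jS /negPf jk]].
  by rewrite /resample (negPf (notin_forward _ _)) eqxx cardT size_enum_ord muln1.
by rewrite /resample jS jk card1.
Qed.

(** If [k] is rejected, only the vertices mapped to [k] stop being forward. If it is chosen, there
    are none of these, and [k] itself joins exactly when its value is still ahead. *)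
Lemma forwardS f k :
  forward f k.+1 =
  if (f k \notin mis_prefix f k) && [forall u in forward f k, f u != k]
  then (if (k < f k)%N then k |: forward f k else forward f k)
  else [set j in forward f k | f j != k].
Proof.
rewrite /forward mis_prefixS; case: ifP => [/andP[fk /forallP nof]|_]; last first.
  apply/setP => j; rewrite !inE; case: (j \in _) => //=.
  by rewrite ltn_neqAle eq_sym andbC.
have eqS (j : 'I_n) : (j \in mis_prefix f k) && (k < f j)%N
    = (j \in mis_prefix f k) && (k <= f j)%N.
  case: (boolP (j \in _)) => //= jI; have := nof j; rewrite inE jI /= ltn_neqAle.
  case: leqP => /= [_ /negPf fjk|_ _]; last by rewrite andbF.
  by rewrite andbT val_eqE eq_sym fjk.
case: ifP => kf; apply/setP => j; rewrite !inE; case: (eqVneq j k) => [->|jk] /=;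
  by rewrite ?eqS ?kf ?(negPf (notin_mis_prefix _ _)).
Qed.

(** * Average of one exploration step over a class *)

Variable R : realFieldType.
Implicit Types (phi : nat -> R) (c : R).

(* The product over j of [weight k S a c v j (f j)] is v (f k) times c to the
   number of j in S with f j <> k, times a to the number of the other j in S:
   with a = 0 it vanishes as soon as some j in S is mapped to k. *)
Definition weight k (S : {set 'I_n}) (a c : R) (v : 'I_n -> R) (j x : 'I_n) : R :=
  if j \in S then (if x == k then a else c) else if j == k then v x else 1.

(* Increment of [phi(A) c^D], divided by c^D for the old D, if no chosen vertex is
   mapped to k and f k = x. *)
Definition gain k (I : {set 'I_n}) phi c (x : 'I_n) : R :=
  if (k < x)%N then c * phi #|I|.+1 - phi #|I|
  else if x \in I then 0 else phi #|I|.+1 - phi #|I|.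

(** The first term is the new value as if [k] were rejected; the second corrects it and vanishes
    once a forward vertex hits [k]. Both are products over coordinates, ready for
    [weight_average]. *)
Lemma exploration_step k f phi c :
  phi #|mis_prefix f k.+1| * c ^+ #|forward f k.+1| =
  phi #|mis_prefix f k| * (\prod_j weight k (forward f k) 1 c (fun=> 1) j (f j))
  + \prod_j weight k (forward f k) 0 c (gain k (mis_prefix f k) phi c) j (f j).
Proof.
have weightE a v : \prod_j weight k (forward f k) a c v j (f j) =
    (\prod_(j in forward f k) (if f j == k then a else c)) * v (f k).
  rewrite (bigID (mem (forward f k))) /=; congr (_ * _).
    by apply: eq_bigr => j jS; rewrite /weight jS.
  rewrite (bigD1 k) ?notin_forward //= big1 => [|j /andP[/negPf jS /negPf jk]].
    by rewrite /weight (negPf (notin_forward _ _)) eqxx mulr1.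
  by rewrite /weight jS jk.
have prod1 : \prod_(j in forward f k) (if f j == k then 1 else c)
    = c ^+ #|[set j in forward f k | f j != k]|.
  rewrite -prodr_const big_mkcond [RHS]big_mkcond; apply: eq_bigr => j _.
  by rewrite !inE; case: (_ && _); case: eqP.
rewrite !weightE mulr1 prod1 mis_prefixS forwardS.
case: (boolP [forall u in _, _]) => [/forallP nof|]; last first.
  rewrite negb_forall => /existsP[u]; rewrite negb_imply negbK => /andP[uS fu].
  by rewrite andbF (bigD1 u) //= fu !mul0r addr0.
have -> : [set j in forward f k | f j != k] = forward f k.
  by apply/setP => j; rewrite inE; case: (boolP (j \in _)) (nof j) => // _ ->.
rewrite (eq_bigr (fun=> c)) => [|j jS]; last by have := nof j; rewrite jS => /negPf ->.
rewrite prodr_const andbT /gain; case: (boolP (f k \in _)) => /= fk.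
  by rewrite ltnNge (ltnW (mis_prefix_lt fk)) /= mulr0 addr0.
rewrite cardsU1 notin_mis_prefix add1n.
by case: ifP => _; rewrite ?cardsU1 ?notin_forward ?add1n ?exprS; ring.
Qed.

(** Each forward value is uniform on [n - k] points, exactly one of which is [k]; the value at [k]
    is uniform on all [n] points. *)
Lemma weight_average k f (a c : R) (v : 'I_n -> R) :
  (\sum_(g | resampled k f g) \prod_j weight k (forward f k) a c v j (g j))
    / #|resampled k f|%:R =
  ((a + (n - k.+1)%:R * c) / (n - k)%:R) ^+ #|forward f k| * ((\sum_x v x) / n%:R).
Proof.
rewrite [LHS](sum_family (resample f k)) (bigID (mem (forward f k))) /=; congr (_ * _).
  rewrite -prodr_const; apply: eq_bigr => j jS.
  rewrite /resample /weight jS card_ord_ge 1?ltnW //; congr (_ / _).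
  rewrite (bigD1 k) ?inE //= eqxx; congr (_ + _).
  rewrite (eq_bigl [pred x : 'I_n | (k < x)%N]) => [|x]; last first.
    by rewrite !inE ltn_neqAle eq_sym andbC.
  rewrite (eq_bigr (fun=> c)) ?sumr_const => [|x]; last first.
    by rewrite inE -val_eqE /= => /gtn_eqF ->.
  by rewrite card_ord_ge // mulr_natl.
rewrite (bigD1 k) ?notin_forward //= [X in _ * X]big1 => [|j /andP[/negPf jS /negPf jk]].
  rewrite /resample /weight (negPf (notin_forward _ _)) eqxx mulr1.
  by rewrite cardT size_enum_ord.
by rewrite /resample /weight jS jk card1 big_pred1_eq divr1.
Qed.

Lemma sum_gain k f phi c :
  \sum_x gain k (mis_prefix f k) phi c x =
  (n - k.+1)%:R * (c - 1) * phi #|mis_prefix f k|.+1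
  + (n%:R - #|mis_prefix f k|%:R) * (phi #|mis_prefix f k|.+1 - phi #|mis_prefix f k|).
Proof.
set I := mis_prefix f k.
pose d := phi #|I|.+1 - phi #|I|.
(* Chosen vertices lie below [k], so the cases [k < x] and [x \in I] are disjoint and their
   contributions separate. *)
have -> : \sum_x gain k I phi c x =
    \sum_(x : 'I_n) ((if (k < x)%N then (c - 1) * phi #|I|.+1 else 0)
   + d - (if x \in I then d else 0)).
  apply: eq_bigr => x _; rewrite /gain -/d; case: ifP => [kx|_].
    case: ifP => [/mis_prefix_lt xk|_]; first by rewrite ltnNge (ltnW xk) in kx.
    by rewrite /d; ring.
  by case: ifP => _; ring.
rewrite sumrB big_split /= -!big_mkcond /= !sumr_const card_ord.
rewrite (card_ord_ge (ltn_ord k)) -/d.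
rewrite -[in LHS](mulr_natl _ (n - k.+1)) -[d *+ n]mulr_natl -[d *+ _]mulr_natl.
by set m := (n - k.+1)%N; ring.
Qed.

(** * Moments of the exploration and their recursion *)

Definition mean (F : {ffun 'I_n -> 'I_n} -> R) : R :=
  (\sum_f F f) / #|{: {ffun 'I_n -> 'I_n}}|%:R.

(** The base [1 + t / (n - i)] makes the family stable: averaging one step yields bases of the same
    shape with parameters [t] and [t - 1]. *)
Definition moment (t : R) phi i : R :=
  mean (fun f => phi #|mis_prefix f i| * (1 + t / (n - i)%:R) ^+ #|forward f i|).

Lemma momentS t phi i : (i.+1 < n)%N ->
  moment t phi i.+1 = moment t phi i
  + moment (t - 1) (fun a => t * phi a.+1 + (n%:R - a%:R) * (phi a.+1 - phi a)) i / n%:R.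
Proof.
move=> lt_i1n; have lt_in : (i < n)%N by apply: ltnW.
have [k ik] : exists k : 'I_n, i = k by exists (Ordinal lt_in).
rewrite {i}ik in lt_i1n lt_in *.
rewrite /moment /mean -mulrAC -mulrDl; congr (_ / _).
rewrite mulr_suml -big_split /=.
(* Condition on the past: it suffices to prove the identity on each class, where [mis_prefix] and
   [forward] at [k] are constant. *)
rewrite (@sum_class_average _ _ (resampled k)); last first.
- by move=> f g fg; rewrite !card_resampled (resampled_forward fg).
- exact: resampled_sym.
- exact: resampled_refl.
apply: eq_bigr => f _; set c := 1 + t / (n - k.+1)%:R.
rewrite (eq_bigr (fun g : {ffun 'I_n -> 'I_n} =>
    phi #|mis_prefix f k| * (\prod_j weight k (forward f k) 1 c (fun=> 1) j (g j))
  + \prod_j weight k (forward f k) 0 c (gain k (mis_prefix f k) phi c) j (g j))); last first.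
  move=> g fg; rewrite exploration_step.
  by rewrite (resampled_forward fg) (resampled_mis_prefix fg).
rewrite big_split /= -mulr_sumr mulrDl -mulrA !weight_average sum_gain.
have n0 : n%:R != 0 :> R by rewrite pnatr_eq0 -lt0n (leq_ltn_trans _ lt_in).
have m0 : (n - k.+1)%:R != 0 :> R by rewrite pnatr_eq0 -lt0n subn_gt0.
have mS : (n - k)%:R = (n - k.+1)%:R + 1 :> R by rewrite -(subnSK lt_in) natr1.
have mS0 : (n - k.+1)%:R + 1 != 0 :> R by rewrite -mS pnatr_eq0 -lt0n subn_gt0.
rewrite sumr_const card_ord divff // mulr1 mS.
(* The two bases produced by [weight_average] for [a = 1] and [a = 0]. *)
have -> : (1 + (n - k.+1)%:R * c) / ((n - k.+1)%:R + 1) = 1 + t / ((n - k.+1)%:R + 1).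
  by rewrite /c; field; rewrite m0 mS0.
have -> : (0 + (n - k.+1)%:R * c) / ((n - k.+1)%:R + 1) = 1 + (t - 1) / ((n - k.+1)%:R + 1).
  by rewrite /c; field; rewrite m0 mS0.
have -> : (n - k.+1)%:R * (c - 1) = t by rewrite /c; field.
by congr (_ + _); ring.
Qed.

Lemma eq_moment t phi psi i : phi =1 psi -> moment t phi i = moment t psi i.
Proof. by move=> e; congr (_ / _); apply: eq_bigr => f _; rewrite e. Qed.

Lemma card_ffun_neq0 : #|{: {ffun 'I_n -> 'I_n}}|%:R != 0 :> R.
Proof.
rewrite pnatr_eq0 -lt0n; apply/card_gt0P.
by exists [ffun x => x].
Qed.

Lemma mean_cst c : mean (fun=> c) = c.
Proof. by rewrite /mean sumr_const -[X in X / _]mulr_natr mulfK // card_ffun_neq0. Qed.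

Lemma moment_cst t c i : moment t (fun=> c) i = c * moment t (fun=> 1) i.
Proof.
rewrite /moment /mean mulrA mulr_sumr; congr (_ / _).
by apply: eq_bigr => f _; rewrite mul1r.
Qed.

Lemma moment_at0 t phi : moment t phi 0 = phi 0%N.
Proof.
rewrite -[RHS]mean_cst; congr (_ / _); apply: eq_bigr => f _.
rewrite mis_prefix0 cards0.
have -> : forward f 0 = finset.set0 by apply/setP => j; rewrite inE mis_prefix0 !inE.
by rewrite cards0 mulr1.
Qed.

Lemma moment0_cst c i : moment 0 (fun=> c) i = c.
Proof.
rewrite -[RHS]mean_cst; congr (_ / _); apply: eq_bigr => f _.
by rewrite mul0r addr0 expr1n mulr1.
Qed.

Lemma moment_invariant t phi i : (i < n)%N ->
  (forall a, t * phi a.+1 + (n%:R - a%:R) * (phi a.+1 - phi a) = 0) ->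
  moment t phi i = phi 0%N.
Proof.
move=> lt_in phi0; elim: i lt_in => [|i IHi] lt_in; first by rewrite moment_at0.
by rewrite momentS // (eq_moment _ _ phi0) moment_cst mul0r mul0r addr0 IHi // ltnW.
Qed.

Lemma moment1_1 i : (i < n)%N -> moment 1 (fun=> 1) i = 1 + i%:R / n%:R.
Proof.
elim: i => [|i IHi] lt_in; first by rewrite moment_at0 mul0r addr0.
rewrite momentS // subrr (@eq_moment 0 _ (fun=> 1)) => [|a]; last by ring.
rewrite moment0_cst IHi 1?ltnW //.
by rewrite -addrA -mulrDl natr1.
Qed.

(** The increment is [2 / n] times the linear moment [1 + i / n]; the subtracted term is the
    discrete correction to the square. *)
Lemma moment2_1 i : (i < n)%N ->
  moment 2 (fun=> 1) i = (1 + i%:R / n%:R) ^+ 2 - i%:R / n%:R ^+ 2.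
Proof.
elim: i => [|i IHi] lt_in; first by rewrite moment_at0 !mul0r addr0 subr0 expr1n.
have n0 : n%:R != 0 :> R by rewrite pnatr_eq0 -lt0n (leq_ltn_trans _ lt_in).
rewrite momentS // (@eq_moment (2 - 1) _ (fun=> 2)) => [|a]; last by ring.
rewrite (moment_cst (2 - 1)) IHi 1?ltnW //.
have -> : 2 - 1 = 1 :> R by ring.
by rewrite moment1_1 1?ltnW // -natr1; field.
Qed.

Lemma moment1_remaining i : (i < n)%N ->
  moment 1 (fun a => n.+1%:R - a%:R) i = n.+1%:R.
Proof.
move=> lt_in; rewrite moment_invariant ?subr0 // => a.
by rewrite -!natr1; ring.
Qed.

Lemma moment2_remaining i : (i < n)%N ->
  moment 2 (fun a => (n.+1%:R - a%:R) * (n.+2%:R - a%:R)) i = n.+1%:R * n.+2%:R.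
Proof.
move=> lt_in; rewrite moment_invariant ?subr0 // => a.
by rewrite -!natr1; ring.
Qed.

End Exploration.

(** * Second moment estimate *)

Lemma exprn1D_le (R : realFieldType) (t : R) (d : nat) :
  0 <= t -> d%:R * t <= 1 / 2 -> (1 + t) ^+ d <= 1 + 2 * (d%:R * t).
Proof.
(* With [s = d t] at most 1/2, this gives the claim through [1 / (1 - s) <= 1 + 2 s]. *)
move=> t0 dt; have le1 : (1 + t) ^+ d * (1 - d%:R * t) <= 1.
  elim: d {dt} => [|d IHd]; first by rewrite expr0 mul0r subr0 mulr1.
  apply: le_trans IHd; rewrite exprSr -mulrA ler_wpM2l ?exprn_ge0 ?addr_ge0 //.
  have := mulr_ge0 (mulr_ge0 (ler0n R d) t0) t0; have := mulr_ge0 t0 t0.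
  by rewrite -natr1; lra.
have dt0 : 0 <= d%:R * t by rewrite mulr_ge0.
have lt0 : 0 < 1 - d%:R * t by lra.
by rewrite -(ler_pM2r lt0) (le_trans le1) //; nra.
Qed.

Section SecondMoment.
Variables (n : nat) (R : realFieldType).
Implicit Types (f : {ffun 'I_n -> 'I_n}) (F : {ffun 'I_n -> 'I_n} -> R).

Lemma meanD F G : mean (fun f => F f + G f) = mean F + mean G.
Proof. by rewrite /mean big_split mulrDl. Qed.

Lemma meanZ c F : mean (fun f => c * F f) = c * mean F.
Proof. by rewrite /mean -mulr_sumr mulrA. Qed.

Lemma le_mean F G : (forall f, F f <= G f) -> mean F <= mean G.
Proof. by move=> FG; rewrite ler_wpM2r ?invr_ge0 ?ler_sum. Qed.

Lemma card_mis_prefix_le f i : (#|mis_prefix f i| <= n)%N.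
Proof. by rewrite -[leqRHS]card_ord max_card. Qed.

Lemma second_moment i : (i < n)%N -> n%:R / (n - i)%:R ^+ 2 <= 1 / 2 :> R ->
  mean (fun f => (n.+1%:R - (n.+1%:R - #|mis_prefix f i|%:R) * (1 + i%:R / n%:R)) ^+ 2)
  <= 2 * n.+1%:R + 24 * (n%:R / (n - i)%:R ^+ 2) * n.+1%:R ^+ 2 :> R.
Proof.
move=> lt_in; set m : R := (n - i)%:R => small.
have m0 : 0 < m by rewrite ltr0n subn_gt0.
have n0 : 0 < n%:R :> R by rewrite ltr0n (leq_ltn_trans _ lt_in).
set x : R := i%:R / n%:R; set p : R := n.+1%:R.
set e : R := 2 * (n%:R / m ^+ 2).
have e0 : 0 <= e by rewrite mulr_ge0 // divr_ge0 // exprn_ge0 // ltW.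
have x0 : 0 <= x by rewrite divr_ge0.
have x1 : x <= 1 by rewrite ler_pdivrMr // mul1r ler_nat ltnW.
have p1 : 1 <= p by rewrite ler1n.
pose Z f : R := (1 + 1 / m) ^+ #|forward f i|.
pose Y f : R := (1 + 2 / m) ^+ #|forward f i|.
pose B f : R := p - #|mis_prefix f i|%:R.
(* Compare bases: [(1 + 1/m)^2 <= (1 + 1/m^2) (1 + 2/m)], and the excess factor [(1 + 1/m^2)^d] is
   at most [1 + e] because [d <= n]. *)
have ZY f : Z f ^+ 2 <= (1 + e) * Y f.
  rewrite /Z /Y; set d := #|_|.
  have dn : d%:R <= n%:R :> R by rewrite ler_nat -[leqRHS]card_ord max_card.
  have t0 : 0 <= 1 / m ^+ 2 by rewrite divr_ge0 ?exprn_ge0 // ltW.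
  have dt : d%:R * (1 / m ^+ 2) <= n%:R / m ^+ 2 by rewrite mul1r ler_wpM2r // -[_^-1]mul1r.
  apply: (@le_trans _ _ ((1 + 1 / m ^+ 2) ^+ d * (1 + 2 / m) ^+ d)); last first.
    apply: ler_wpM2r; first by rewrite exprn_ge0 // addr_ge0 // divr_ge0 // ltW.
    by apply: le_trans (exprn1D_le t0 _) _; rewrite ?(le_trans dt) // lerD2l ler_wpM2l.
  rewrite -exprM mulnC exprM -exprMn.
  rewrite lerXn2r ?nnegrE ?exprn_ge0 ?mulr_ge0 ?addr_ge0 ?divr_ge0 ?exprn_ge0 ?(ltW m0) //.
  have : 0 <= 1 / m ^+ 2 * (2 / m) by rewrite mulr_ge0 // divr_ge0 // ltW.
  move=> h; rewrite -subr_ge0.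
  have -> : (1 + 1 / m ^+ 2) * (1 + 2 / m) - (1 + 1 / m) ^+ 2 = 1 / m ^+ 2 * (2 / m).
    by field; rewrite gt_eqF.
  exact: h.
have EZ : mean Z = 1 + x.
  by rewrite -moment1_1 //; congr (_ / _); apply: eq_bigr => f _; rewrite mul1r.
have EY : mean Y <= (1 + x) ^+ 2.
  have -> : mean Y = moment n (2 : R) (fun=> 1) i.
    by congr (_ / _); apply: eq_bigr => f _; rewrite mul1r.
  by rewrite moment2_1 // gerBl divr_ge0 ?exprn_ge0.
have EBZ : mean (fun f => B f * Z f) = p by apply: moment1_remaining.
have EBY : mean (fun f => B f * (B f + 1) * Y f) = p * (p + 1).
  rewrite /p natr1 -(moment2_remaining R lt_in).
  by congr (_ / _); apply: eq_bigr => f _; congr (_ * _); rewrite /B /p -!natr1; ring.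
have B0 f : 0 <= B f by rewrite subr_ge0 ler_nat leqW // card_mis_prefix_le.
have Bp f : B f <= p by rewrite gerBl.
have Y0 f : 0 <= Y f by rewrite exprn_ge0 // addr_ge0 // divr_ge0 // ltW.
(* Split [p - B (1 + x)] as [(p - B Z) + B (Z - (1 + x))], use [(u + v)^2 <= 2 u^2 + 2 v^2] and
   [B <= p], expand, then replace [Z^2] by [(1 + e) Y] and [B^2] by [B (B + 1)]. All remaining means
   are known or bounded. *)
pose bound f : R := 2 * (1 + e) * (B f * (B f + 1) * Y f) + - (4 * p) * (B f * Z f)
  + (2 * p ^+ 2 * (1 + e) * Y f + - (4 * p ^+ 2 * (1 + x)) * Z f
  + (2 * p ^+ 2 + 2 * p ^+ 2 * (1 + x) ^+ 2)).
apply: (@le_trans _ _ (mean bound)).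
  apply: le_mean => f; rewrite -/(B f).
  apply: (@le_trans _ _ (2 * (p - B f * Z f) ^+ 2 + 2 * p ^+ 2 * (Z f - (1 + x)) ^+ 2)).
    have : B f ^+ 2 * (Z f - (1 + x)) ^+ 2 <= p ^+ 2 * (Z f - (1 + x)) ^+ 2.
      by rewrite ler_wpM2r ?sqr_ge0 // lerXn2r ?nnegrE // (le_trans _ (Bp f)).
    have := sqr_ge0 (p - B f * Z f - B f * (Z f - (1 + x))).
    by move: (x) (p) (B f) (Z f) => x' p' b z h1 h2; lra.
  have h1 : B f ^+ 2 * Z f ^+ 2 <= (1 + e) * (B f * (B f + 1) * Y f).
    apply: (@le_trans _ _ (B f ^+ 2 * ((1 + e) * Y f))).
      by rewrite ler_wpM2l ?sqr_ge0.
    have := mulr_ge0 (B0 f) (mulr_ge0 (addr_ge0 ler01 e0) (Y0 f)).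
    by move: (e) (B f) (Y f) => e' b y; lra.
  have h2 : p ^+ 2 * Z f ^+ 2 <= p ^+ 2 * ((1 + e) * Y f).
    by rewrite ler_wpM2l ?sqr_ge0.
  by rewrite /bound; move: (x) (p) (e) (B f) (Z f) (Y f) h1 h2 => x' p' e' b z y; lra.
rewrite /bound !meanD !meanZ !mean_cst EZ EBZ EBY.
(* The main terms cancel, leaving [2 p + 2 e p (p + 1) + 2 e p^2 (1 + x)^2], at most
   [2 p + 12 e p^2]. *)
have h1 : 2 * p ^+ 2 * (1 + e) * mean Y <= 2 * p ^+ 2 * (1 + e) * (1 + x) ^+ 2.
  by rewrite ler_wpM2l // !mulr_ge0 ?addr_ge0 ?sqr_ge0.
have h2 : p ^+ 2 * e * (1 + x) ^+ 2 <= p ^+ 2 * e * 4.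
  by rewrite ler_wpM2l ?mulr_ge0 ?sqr_ge0 //; nra.
have h3 : e * p <= e * p ^+ 2 by rewrite ler_wpM2l //; nra.
rewrite -/p (_ : 24 * (n%:R / m ^+ 2) = 12 * e); last by rewrite /e; ring.
by move: (mean Y) (p) (x) (e) h1 h2 h3 => y p' x' e' h1 h2 h3; lra.
Qed.

Lemma card_mis_prefixD f i j : (i + j <= n)%N ->
  (#|mis_prefix f i| <= #|mis_prefix f (i + j)| <= #|mis_prefix f i| + j)%N.
Proof.
elim: j => [|j IHj] ijn; first by rewrite !addn0 leqnn.
rewrite addnS in ijn *; have /andP[lo hi] := IHj (ltnW ijn).
rewrite -[(i + j)%N]/(nat_of_ord (Ordinal ijn)) in lo hi *.
rewrite mis_prefixS; case: ifP => _; last by rewrite lo (leq_trans hi) // leq_add2l.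
by rewrite cardsU1 notin_mis_prefix add1n addnS ltnS hi leqW.
Qed.

End SecondMoment.

(** * From the second moment to a deviation probability *)

Section Deviation.
Variables (n : nat) (R : realType).
Implicit Types (f : {ffun 'I_n -> 'I_n}) (F : {ffun 'I_n -> 'I_n} -> R).

Lemma chebyshev_mean (E : pred {ffun 'I_n -> 'I_n}) F c : 0 < c ->
  (forall f, 0 <= F f) -> (forall f, E f -> c <= F f) ->
  unif_prob R E <= mean F / c.
Proof.
move=> c0 F0 EF; rewrite /unif_prob /mean mulrAC ler_wpM2r ?invr_ge0 //.
rewrite ler_pdivlMr // -[_%:R](@sumr_const R _ _ 1)  mulr_suml.
rewrite big_mkcond; apply: ler_sum => f _; rewrite inE mul1r.
by case: ifP => [/EF|].
Qed.

(** Chebyshev at time [n - m], where [1 + (n - m) / n] is nearly 2; the last [m] vertices change the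
    count by at most [m]. *)
Lemma deviation_prob (delta : R) m : (0 < m <= n)%N -> 0 < delta ->
  4 * m%:R + 1 <= delta * n%:R -> n%:R / m%:R ^+ 2 <= 1 / 2 :> R ->
  unif_prob R (fun f => `|#|mis_prefix f n|%:R / n%:R - 1 / 2| > delta)
  <= (2 * n.+1%:R + 24 * (n%:R / m%:R ^+ 2) * n.+1%:R ^+ 2) / (delta * n%:R) ^+ 2.
Proof.
move=> /andP[m0 mn] d0 dm small.
have n0 : 0 < n%:R :> R by rewrite ltr0n (leq_trans m0).
have lt_in : (n - m < n)%N by rewrite ltn_subrL m0 (leq_trans m0).
have := second_moment lt_in; rewrite subKn // => /(_ R small) sm.
have c0 : 0 < (delta * n%:R) ^+ 2 by rewrite exprn_gt0 // mulr_gt0.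
apply: le_trans (ler_wpM2r _ sm); last by rewrite invr_ge0 ltW.
apply: chebyshev_mean => // f; first exact: sqr_ge0.
have /andP[] : (#|mis_prefix f (n - m)| <= #|mis_prefix f n| <= #|mis_prefix f (n - m)| + m)%N.
  by have := @card_mis_prefixD n f (n - m) m; rewrite subnK // leqnn; apply.
have : (#|mis_prefix f (n - m)| <= n)%N by apply: card_mis_prefix_le.
rewrite -!(ler_nat R) natrD; set a := _%:R; set b := #|mis_prefix f n|%:R.
move=> an ab bam; rewrite natrB // -[n.+1%:R]natr1.
have -> : 1 + (n%:R - m%:R) / n%:R = 2 - m%:R / n%:R :> R by field; rewrite gt_eqF.
set y : R := m%:R / n%:R.
have a0 : 0 <= a by rewrite ler0n.
have yn : y * n%:R = m%:R by rewrite mulfVK // gt_eqF.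
have y0 : 0 <= y by rewrite divr_ge0.
have y1 : y <= 1 by rewrite ler_pdivrMr // mul1r ler_nat.
have ya : 0 <= y * a by rewrite mulr_ge0.
have ya' : y * a <= m%:R by rewrite -yn ler_wpM2l.
have m1 : 1 <= m%:R :> R by rewrite ler1n.
rewrite -[_ < _](ltr_pM2r n0) -[X in _ < _ * X](gtr0_norm n0) -normrM mulrBl mulfVK ?gt_eqF //.
rewrite ltr_normr => dev.
rewrite -[leRHS]real_normK ?num_real // lerXn2r ?nnegrE ?normr_ge0 //.
  by rewrite mulr_ge0 // ltW.
(* This differs from [2 b - n] by at most [2 m + 1], while [dev] makes [2 b - n] exceed [2 delta n]
   in absolute value; so at least [delta n] remains. *)
have -> : n%:R + 1 - (n%:R + 1 - a) * (2 - y) = 2 * a - n%:R - 1 + m%:R + y - y * a.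
  by rewrite -yn; ring.
by rewrite ler_normr; case/orP: dev => dev; apply/orP; [left|right]; lra.
Qed.

End Deviation.

(** * Removing the random ordering by conjugation *)

Lemma card_pred_sum (U : finType) (Q : pred U) :
  #|[pred x | Q x]| = (\sum_x nat_of_bool (Q x))%N.
Proof.
by rewrite -sum1_card big_mkcond; apply: eq_bigr => x _; rewrite inE; case: (Q x).
Qed.

Section Relabel.
Variable T : finType.
Implicit Types (f : {ffun T -> T}) (s : {perm T}).

Definition conj_fun s f : {ffun T -> T} := [ffun x => s (f ((s^-1)%g x))].

Lemma conj_fun_bij s : bijective (conj_fun s).
Proof.
exists (conj_fun (s^-1)%g) => f; apply/ffunP => x; rewrite !ffunE.
  by rewrite invgK !permK.
by rewrite invgK !permKV.
Qed.

(** [s] is an isomorphism from the graph of [f] to that of its conjugate, and carries [enum T] to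
    [vertex_order s]. *)
Lemma greedy_mis_conj s f :
  greedy_mis (underlying (functional_digraph (conj_fun s f))) s
  = s @: greedy_set (underlying (functional_digraph f)) (enum T).
Proof.
apply: greedy_set_map => x y; rewrite /= /underlying_rel /functional_digraph.
by rewrite !ffunE !permK !(inj_eq perm_inj).
Qed.

(** For each fixed [s], conjugation permutes the functions and preserves the size of the greedy set,
    so every ordering gives the same count. *)
Lemma unif_prob_conj (R : realType) (P : pred R) :
  @unif_prob R ({ffun T -> T} * {perm T})%type
    (fun w => P (greedy_ratio (underlying (functional_digraph w.1)) R w.2))
  = unif_prob R (fun f : {ffun T -> T} =>
      P (#|greedy_set (underlying (functional_digraph f)) (enum T)|%:R / #|T|%:R)).
Proof.
set Q := fun f : {ffun T -> T} => P _.
have cardQ s : #|[pred f | P (greedy_ratio (underlying (functional_digraph f)) R s)]|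
    = #|[pred f | Q f]|.
  rewrite -!sum1_card (reindex (conj_fun s)) /=; last exact: onW_bij (conj_fun_bij s).
  apply: eq_bigl => f; rewrite !inE /greedy_ratio greedy_mis_conj.
  by rewrite card_imset //; apply: perm_inj.
have ratioM (a b c d : nat) : (0 < d)%N -> c = (a * d)%N ->
    c%:R / (b * d)%:R = a%:R / b%:R :> R.
  by move=> d0 ->; rewrite !natrM -mulf_div divff ?mulr1 // pnatr_eq0 -lt0n.
rewrite /unif_prob card_prod; apply: ratioM.
  by apply/card_gt0P; exists 1%g.
rewrite card_pred_sum -(pair_bigA _ (fun f s => nat_of_bool
  (P (greedy_ratio (underlying (functional_digraph f)) R s)))) exchange_big /=.
transitivity (\sum_(s : {perm T}) #|[pred f | Q f]|)%N.
  by apply: eq_bigr => s _; rewrite -card_pred_sum; apply: cardQ.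
by rewrite sum_nat_const mulnC.
Qed.

End Relabel.

(** * Choice of parameters and the limit *)

Local Open Scope classical_set_scope.
Local Open Scope ring_scope.

Theorem mainTheorem6 (R : realType) (delta : R) (delta_gt0 : 0 < delta) :
  (fun n : nat =>
     @unif_prob R ({ffun 'I_n -> 'I_n} * {perm 'I_n})%type
       (fun w => `| greedy_ratio (underlying (functional_digraph w.1)) R w.2
                    - 1 / 2%:R | > delta))
    @ \oo --> (0 : R).
Proof.
(* Capping [delta] at 1 keeps the [m] chosen below at most [n]. *)
have [d [d0 d1 dd]] : exists d, [/\ 0 < d, d <= 1 & d <= delta].
  by exists (Num.min delta 1); rewrite lt_min delta_gt0 ltr01 !ge_min !lexx orbT.
have [g gE] : exists g, g = d / 16 by exists (d / 16).
have g0 : 0 < g by rewrite gE divr_gt0.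
apply/cvgrPdist_lt => e e0; near=> n.
have n0 : 0 < n%:R :> R by near: n; exact: nbhs_infty_gtr.
have n1 : 1 / g < n%:R by near: n; exact: nbhs_infty_gtr.
have n2 : 2 / g ^+ 2 < n%:R by near: n; exact: nbhs_infty_gtr.
(* The final numerator is at most [(4 + 96 / g^2) n], to be beaten by [e (delta n)^2]. *)
have n3 : (4 + 96 / g ^+ 2) / (delta ^+ 2 * e) < n%:R by near: n; exact: nbhs_infty_gtr.
have dn16 : 16 < d * n%:R by move: n1; rewrite ltr_pdivrMr // gE; lra.
(* With [m] the floor of [d n / 8] and [d n > 16], both [4 m + 1 <= d n] and [m >= d n / 16 = g n]
   hold. *)
have [m /andP[m_lo m_hi]] : exists m, (m%:R : R) <= d * n%:R / 8 < m.+1%:R.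
  exists (Num.truncn (d * n%:R / 8)); apply: truncn_itv.
  by rewrite divr_ge0 // mulr_ge0 // ltW.
rewrite -[m.+1%:R]natr1 in m_hi.
have gm : g * n%:R <= m%:R by rewrite gE; lra.
have m1 : 0 < m%:R :> R by lra.
have dn : d * n%:R <= n%:R by rewrite ler_piMl // ltW.
have mn : (0 < m <= n)%N.
  by rewrite -(ltr0n R) m1 -(ler_nat R); lra.
have dnd : d * n%:R <= delta * n%:R by rewrite ler_wpM2r // ltW.
have ratio : n%:R / m%:R ^+ 2 <= 1 / (g ^+ 2 * n%:R) :> R.
  rewrite ler_pdivrMr ?exprn_gt0 // mulrAC ler_pdivlMr ?mulr_gt0 ?exprn_gt0 // mul1r.
  have : (g * n%:R) ^+ 2 <= m%:R ^+ 2 by rewrite lerXn2r // nnegrE ltW // mulr_gt0.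
  by lra.
have small : n%:R / m%:R ^+ 2 <= 1 / 2 :> R.
  apply: le_trans ratio _; rewrite ler_pdivrMr ?mulr_gt0 ?exprn_gt0 //.
  by move: n2; rewrite ltr_pdivrMr ?exprn_gt0 //; lra.
have := deviation_prob mn delta_gt0 _ small => /(_ _)/wrap[]; first by lra.
move=> dev; rewrite sub0r normrN.
have -> := unif_prob_conj _ (fun r : R => `|r - 1 / 2| > delta).
rewrite card_ord.
have pE : unif_prob R (fun f : {ffun 'I_n -> 'I_n} =>
      `|#|greedy_set (underlying (functional_digraph f)) (enum 'I_n)|%:R / n%:R - 1 / 2| > delta)
   = unif_prob R (fun f : {ffun 'I_n -> 'I_n} => `|#|mis_prefix f n|%:R / n%:R - 1 / 2| > delta).
  by rewrite /mis_prefix take_oversize // size_enum_ord.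
rewrite pE ger0_norm ?divr_ge0 //; apply: le_lt_trans dev _.
rewrite ltr_pdivrMr ?exprn_gt0 ?mulr_gt0 //.
have n1' : 1 <= n%:R :> R by lra.
have key : (4 + 96 / g ^+ 2) * n%:R < e * (delta * n%:R) ^+ 2.
  move: n3; rewrite ltr_pdivrMr ?mulr_gt0 ?exprn_gt0 // => n3'.
  have -> : e * (delta * n%:R) ^+ 2 = n%:R * (delta ^+ 2 * e) * n%:R by ring.
  by rewrite ltr_pM2r.
apply: le_lt_trans key; rewrite -[n.+1%:R]natr1.
have sq : (n%:R + 1) ^+ 2 <= 4 * n%:R ^+ 2 :> R by nra.
have h : n%:R / m%:R ^+ 2 * (n%:R + 1) ^+ 2 <= 1 / (g ^+ 2 * n%:R) * (4 * n%:R ^+ 2) :> R.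
  by rewrite ler_pM // ?sqr_ge0 // divr_ge0 // ?sqr_ge0 // ltW.
have : 1 / (g ^+ 2 * n%:R) * (4 * n%:R ^+ 2) = 4 / g ^+ 2 * n%:R.
  by field; rewrite !gt_eqF.
by lra.
Unshelve. all: by end_near.
Qed.
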